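(* Let $K$ be an infinite field that is an extension of a base field $F$, let $R=K[x,y]$ be the polynomial ring in two variables, and let $d_1,d_2\in\mathbb{N}$. Let $f_1\in R_{d_1}$ and $f_2\in R_{d_2}$ be generic forms generating a generic ideal $I=\langle f_1,f_2\rangle$. Let $J=\mathrm{in}(I)$ be the initial ideal of $I$ with respect to the graded reverse lexicographic order with $x>y$. Then $J$ is weakly reverse lexicographic.
   Context: $R=K[x,y]$ is graded by $\deg x=\deg y=1$, and $R_d$ denotes the set of homogeneous polynomials (forms) of total degree $d$. Generic forms: a form $f=\sum_m \alpha_m m$ of degree $d$, where $m$ runs over all monomials of degree $d$ and $\alpha_m\in K$, is generic if the coefficients $\alpha_m$ are pairwise distinct and the set of all $\alpha_m$ is algebraically independent over $F$. ''Generic forms $f_1,f_2$ generating a generic ideal'' means that $I=\langle f_1,f_2\rangle$, each $f_i$ is a generic form, all the coefficients of $f_1$ are different from all the coefficients of $f_2$, and the set of all the coefficients of $f_1$ and $f_2$ together is algebraically independent over $F$. Graded reverse lexicographic order: $x^{\beta_1}y^{\beta_2}>x^{\alpha_1}y^{\alpha_2}$ if $\beta_1+\beta_2>\alpha_1+\alpha_2$, or if $\beta_1+\beta_2=\alpha_1+\alpha_2$ and the right-most nonzero entry of $(\beta_1-\alpha_1,\beta_2-\alpha_2)$ is negative. A monomial $u$ precedes a monomial $v$ if $u>v$. $\mathrm{LM}(f)$ is the largest monomial occurring in a nonzero polynomial $f$ with nonzero coefficient, and $\mathrm{in}(I)=\langle \mathrm{LM}(f): f\in I,\ f\neq 0\rangle$.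 A monomial ideal $J\subset R$ is weakly reverse lexicographic if, whenever a monomial $u$ is a minimal (monomial) generator of $J$, every monomial of the same degree as $u$ which precedes $u$ in the graded reverse lexicographic order with $x>y$ is in $J$. *)

(* Defs.v *)
From HB Require Import structures.
From mathcomp Require Import all_boot all_order all_algebra.
From mathcomp Require Export mpoly.

Set Implicit Arguments.
Unset Strict Implicit.
Unset Printing Implicit Defensive.

Import GRing.Theory.
Local Open Scope ring_scope.

Definition infinite_type (T : eqType) : Prop :=
  forall s : seq T, exists x : T, x \notin s.

(* The field extension is given by its embedding [iota].  Injectivity of [t]
   makes this independence of a set, as opposed to a family. *)
Definition alg_independent (F K : fieldType) (iota : {rmorphism F -> K})
    (A : K -> Prop) : Prop :=
  forall (k : nat) (t : 'I_k -> K),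
    injective t -> (forall i, A (t i)) ->
    forall p : {mpoly F[k]}, mmap iota t p = 0 -> p = 0.

(* A form of degree d has a coefficient, possibly zero, at each monomial of
   degree d, so this does not refer to [msupp f]. *)
Definition form_coeff (n : nat) (K : fieldType) (d : nat) (f : {mpoly K[n]})
    (a : K) : Prop :=
  exists2 m : 'X_{1..n}, mdeg m = d & a = f@_m.

Definition generic_form (F K : fieldType) (iota : {rmorphism F -> K})
    (n d : nat) (f : {mpoly K[n]}) : Prop :=
  [/\ f \is d.-homog,
      forall m m' : 'X_{1..n},
        mdeg m = d -> mdeg m' = d -> f@_m = f@_m' -> m = m'
    & alg_independent iota (form_coeff d f)].

Definition generic_pair (F K : fieldType) (iota : {rmorphism F -> K})
    (n d1 d2 : nat) (f1 f2 : {mpoly K[n]}) : Prop :=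
  [/\ generic_form iota d1 f1, generic_form iota d2 f2,
      forall a b : K, form_coeff d1 f1 a -> form_coeff d2 f2 b -> a <> b
    & alg_independent iota (fun a => form_coeff d1 f1 a \/ form_coeff d2 f2 a)].

Definition ideal_gen (R : comNzRingType) (S : R -> Prop) (p : R) : Prop :=
  exists s : seq (R * R),
    (forall c, c \in s -> S c.2) /\ p = \sum_(c <- s) c.1 * c.2.

Definition monomial_span (n : nat) (K : fieldType) (G : 'X_{1..n} -> Prop) :
    {mpoly K[n]} -> Prop :=
  ideal_gen (fun p => exists2 m, G m & p = 'X_[m]).

Definition monomial_generating_set (n : nat) (K : fieldType)
    (J : {mpoly K[n]} -> Prop) (G : 'X_{1..n} -> Prop) : Prop :=
  forall p, J p <-> monomial_span G p.

Definition monomial_ideal (n : nat) (K : fieldType)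
    (J : {mpoly K[n]} -> Prop) : Prop :=
  exists G, monomial_generating_set J G.

Definition minimal_monomial_generating_set (n : nat) (K : fieldType)
    (J : {mpoly K[n]} -> Prop) (G : 'X_{1..n} -> Prop) : Prop :=
  monomial_generating_set J G /\
  forall G' : 'X_{1..n} -> Prop, (forall m, G' m -> G m) ->
    monomial_generating_set J G' -> forall m, G m -> G' m.

(* A monomial ideal has exactly one minimal set of monomial generators. *)
Definition minimal_monomial_generator (n : nat) (K : fieldType)
    (J : {mpoly K[n]} -> Prop) (u : 'X_{1..n}) : Prop :=
  exists2 G, minimal_monomial_generating_set J G & G u.

(* The canonical order on 'X_{1..n}, used by [mlead], compares equal-degree
   monomials lexicographically.  Here variable 0 is x and variable 1 is y, so
   that x > y. *)
Definition grevlex_gt (n : nat) (b a : 'X_{1..n}) : Prop :=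
  (mdeg a < mdeg b)%N \/
  mdeg b = mdeg a /\
  exists2 i : 'I_n, (b i < a i)%N & forall j : 'I_n, (i < j)%N -> b j = a j.

Definition is_LM (n : nat) (K : fieldType) (f : {mpoly K[n]})
    (m : 'X_{1..n}) : Prop :=
  m \in msupp f /\
  forall m', m' \in msupp f -> m' <> m -> grevlex_gt m m'.

Definition initial_ideal (n : nat) (K : fieldType) (I : {mpoly K[n]} -> Prop) :
    {mpoly K[n]} -> Prop :=
  monomial_span (fun m => exists f, [/\ I f, f <> 0 & is_LM f m]).

Definition weakly_revlex (n : nat) (K : fieldType)
    (J : {mpoly K[n]} -> Prop) : Prop :=
  monomial_ideal J /\
  forall u v : 'X_{1..n}, minimal_monomial_generator J u ->
    mdeg v = mdeg u -> grevlex_gt v u -> J 'X_[v].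

(* Main.v *)
(* In degree d take the first n1 = min(d2, d + 1 - d1) monomial multiples of f1
   and all n2 = d + 1 - d2 monomial multiples of f2, monomials being listed in
   decreasing order.  The minor of their coefficient matrix on the first
   r = n1 + n2 monomials is a polynomial in the generic coefficients; it does
   not vanish identically, since it is 1 at f1 = x^d1, f2 = x^(d2 - n1) y^n1.
   So the first r monomials of degree d are leading monomials.  If d < d1 + d2,
   these multiples span I_d and an element of I_d without the first r monomials
   is 0; if d >= d1 + d2 then r = d + 1.  Hence J_d is spanned by the first r
   monomials in every degree d. *)
Require Import Defs.
From HB Require Import structures.
From mathcomp Require Import all_boot all_order all_algebra.
From mathcomp Require Import zify.

Local Open Scope ring_scope.

Set Implicit Arguments.
Unset Strict Implicit.
Unset Printing Implicit Defensive.

Import GRing.Theory.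

(** * Monomials and the graded reverse lexicographic order *)

Definition bimon (d j : nat) : 'X_{1..2} :=
  [multinom (if i == ord0 then d - j else j)%N | i < 2].

Lemma bimon0 (d j : nat) : bimon d j ord0 = (d - j)%N.
Proof. by rewrite mnmE. Qed.

Lemma bimon1 (d j : nat) : bimon d j ord_max = j.
Proof. by rewrite mnmE. Qed.

Lemma mdeg2E (m : 'X_{1..2}) : mdeg m = (m ord0 + m ord_max)%N.
Proof.
rewrite mdegE big_ord_recl big_ord1; congr (_ + m _)%N; exact: val_inj.
Qed.

Lemma mnm2P (m m' : 'X_{1..2}) :
  m ord0 = m' ord0 -> m ord_max = m' ord_max -> m = m'.
Proof.
move=> h0 h1; apply/mnmP => i.
by case: (unliftP ord0 i) => [k|] ->; rewrite ?(ord1 k) // (_ : lift ord0 0 = ord_max) //;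
  apply: val_inj.
Qed.

Lemma mdeg_bimon (d j : nat) : (j <= d)%N -> mdeg (bimon d j) = d.
Proof. by move=> le_jd; rewrite mdeg2E bimon0 bimon1 subnK. Qed.

Lemma bimonE (m : 'X_{1..2}) : m = bimon (mdeg m) (m ord_max).
Proof. by apply: mnm2P; rewrite ?bimon0 ?bimon1 // mdeg2E addnK. Qed.

Lemma le_mdeg2 (m : 'X_{1..2}) : (m ord_max <= mdeg m)%N.
Proof. by rewrite mdeg2E leq_addl. Qed.

(** The deciding index cannot be that of x: the y exponents would agree, and equal degrees would
    force equal x exponents. Hence [bimon d 0], ..., [bimon d d] lists the monomials of degree d in
    decreasing order. *)
Lemma grevlex_gt2 (u v : 'X_{1..2}) :
  mdeg v = mdeg u -> grevlex_gt v u <-> (v ord_max < u ord_max)%N.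
Proof.
move=> eq_d; split=> [[|[_ [i lt_i gt_i]]]|lt_vu]; first by rewrite eq_d ltnn.
  case: (ltngtP i 1) => [lt_i1||eq_i1];
    last by rewrite -(_ : i = ord_max) //; exact: val_inj.
    have i0 : i = ord0 by apply: val_inj; move: lt_i1; rewrite ltnS leqn0 => /eqP.
    move: (gt_i ord_max lt_i1) lt_i eq_d; rewrite i0 !mdeg2E; lia.
  by rewrite ltnNge -ltnS ltn_ord.
right; split=> //; exists ord_max => // j.
by case: j => [[|[|]]].
Qed.

Lemma grevlex_gtD (n : nat) (w b a : 'X_{1..n}) :
  grevlex_gt b a -> grevlex_gt (b + w)%MM (a + w)%MM.
Proof.
case=> [lt_ab|[eq_d [i lt_i gt_i]]]; first by left; rewrite !mdegD ltn_add2r.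
right; split; first by rewrite !mdegD eq_d.
exists i => [|j /gt_i eq_j]; first by rewrite !mnmDE ltn_add2r.
by rewrite !mnmDE eq_j.
Qed.

Lemma is_LM_mulX (n : nat) (K : fieldType) (f : {mpoly K[n]})
    (w m : 'X_{1..n}) : is_LM f m -> is_LM (f * 'X_[w]) (m + w)%MM.
Proof.
have eqX (m' : 'X_{1..n}) : (m' \in msupp (f * 'X_[w])) =
    (m' \in [seq (w + k)%MM | k <- msupp f]) by apply: perm_mem; exact: msuppMX.
case=> m_f m_max; split=> [|m'].
  by rewrite eqX addmC map_f.
rewrite eqX => /mapP[k k_f ->]; rewrite addmC => neq_km.
by apply: grevlex_gtD; apply: m_max => // eq_km; case: neq_km; rewrite eq_km.
Qed.

Lemma mcoeffMX_if (n : nat) (R : nzRingType) (p : {mpoly R[n]})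
    (w m : 'X_{1..n}) :
  (p * 'X_[w])@_m = if (w <= m)%MM then p@_(m - w)%MM else 0.
Proof.
case: ifPn => [le_wm|nle_wm]; first by rewrite -{1}(submK le_wm) addmC mcoeffMX.
apply: memN_msupp_eq0; rewrite (perm_mem (msuppMX _ _)).
by apply: contra nle_wm => /mapP[k _ ->]; exact: lem_addr.
Qed.

(** * Generated ideals and initial ideals *)

Section Ideals.

Context {R : comNzRingType} {S : R -> Prop}.

Lemma ideal_gen_mem (g : R) : S g -> ideal_gen S g.
Proof.
move=> Sg; exists [:: (1, g)]; split=> [c|].
  by rewrite inE => /eqP->.
by rewrite big_seq1 mul1r.
Qed.

Lemma ideal_gen0 : ideal_gen S 0.
Proof. by exists nil; rewrite big_nil. Qed.

Lemma ideal_genD (p q : R) : ideal_gen S p -> ideal_gen S q -> ideal_gen S (p + q).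
Proof.
move=> [s [Ss ->]] [s' [Ss' ->]]; exists (s ++ s'); split=> [c|].
  by rewrite mem_cat => /orP[/Ss|/Ss'].
by rewrite big_cat.
Qed.

Lemma ideal_genM (a p : R) : ideal_gen S p -> ideal_gen S (a * p).
Proof.
move=> [s [Ss ->]]; exists [seq (a * c.1, c.2) | c <- s]; split=> [c|].
  by case/mapP=> c' /Ss Sc' ->.
by rewrite big_map mulr_sumr; apply: eq_bigr => c _; rewrite mulrA.
Qed.

Lemma ideal_gen_sum (I : finType) (p : I -> R) :
  (forall i, ideal_gen S (p i)) -> ideal_gen S (\sum_i p i).
Proof.
by move=> Ip; apply: big_ind => [|x y|i _]; [exact: ideal_gen0|exact: ideal_genD|].
Qed.

End Ideals.

(** Some summand has a nonzero coefficient at [u]; being a multiple of some ['X_[m]], it can have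
    one only if [m] divides [u]. *)
Lemma monomial_spanP (n : nat) (K : fieldType) (G : 'X_{1..n} -> Prop)
    (u : 'X_{1..n}) :
  monomial_span G ('X_[u] : {mpoly K[n]}) -> exists2 m, G m & (m <= u)%MM.
Proof.
case=> s [Gs] /(congr1 (mcoeff u)); rewrite mcoeffX eqxx raddf_sum /=.
have [/hasP[c c_s]|no_c] := boolP (has (fun c => (c.1 * c.2)@_u != 0) s).
  have [m Gm ->] := Gs c c_s; rewrite mcoeffMX_if; case: ifP => [le_mu|].
    by exists m.
  by rewrite eqxx.
rewrite big_seq big1 => [|c c_s]; first by move/eqP; rewrite oner_eq0.
by apply/eqP; move/hasPn: no_c => /(_ c c_s); rewrite negbK.
Qed.

(** A monomial multiple of a leading monomial is again one, by [is_LM_mulX], so monomials in the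
    span are themselves leading monomials. *)
Lemma initial_idealX (n : nat) (K : fieldType) (S : {mpoly K[n]} -> Prop)
    (u : 'X_{1..n}) :
  initial_ideal (ideal_gen S) 'X_[u] <->
  exists f, [/\ ideal_gen S f, f <> 0 & is_LM f u].
Proof.
split=> [/monomial_spanP[m [f [If f0 fm]] le_mu]|fu].
  have fu : is_LM (f * 'X_[u - m]) u.
    by rewrite -{2}(submK le_mu) addmC; exact: is_LM_mulX.
  exists (f * 'X_[u - m]); split=> //; first by rewrite mulrC; exact: ideal_genM.
  by move=> f'0; case: fu; rewrite f'0 msupp0.
by apply: ideal_gen_mem; exists u.
Qed.

(** * Sylvester-type minors of generic forms *)

(* A Sylvester matrix: row i of each block is a (resp. b) shifted right by i. *)
Definition shift_mx {R : nzRingType} (n1 n2 r : nat) (a b : nat -> R) :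
    'M[R]_(n1 + n2, r) :=
  \matrix_(i, j) match split i with
    | inl i1 => if (i1 <= j)%N then a (j - i1)%N else 0
    | inr i2 => if (i2 <= j)%N then b (j - i2)%N else 0
    end.

Lemma map_shift_mx (R R' : nzRingType) (phi : {rmorphism R -> R'})
    (n1 n2 r : nat) (a b : nat -> R) :
  map_mx phi (shift_mx n1 n2 r a b) = shift_mx n1 n2 r (phi \o a) (phi \o b).
Proof.
apply/matrixP=> i j; rewrite !mxE; case: split => k /=; case: ifP => //;
  by rewrite rmorph0.
Qed.

Lemma eq_shift_mx (R : nzRingType) (n1 n2 r : nat) (a a' b b' : nat -> R) :
  a =1 a' -> b =1 b' -> shift_mx n1 n2 r a b = shift_mx n1 n2 r a' b'.
Proof.
by move=> eq_a eq_b; apply/matrixP=> i j; rewrite !mxE; case: split => k;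
   rewrite ?eq_a ?eq_b.
Qed.

(** The offset [n1] in the second sequence makes the second block continue the diagonal where the
    first block stops. *)
Lemma shift_mx1 (R : nzRingType) (n1 n2 : nat) :
  shift_mx n1 n2 (n1 + n2) (fun k => (k == 0)%:R) (fun k => (k == n1)%:R)
  = 1%:M :> 'M[R]_(n1 + n2).
Proof.
apply/matrixP=> i j; rewrite !mxE -val_eqE /=.
case: splitP => k ->; case: ifP => le_k; last 1 first.
all: try (congr (_%:R); congr nat_of_bool; lia).
all: rewrite (_ : (_ == _) = false) //; lia.
Qed.

(** The guard is needed because truncated subtraction makes [bimon d k] the monomial y^k, of degree
    k, when k > d. *)
Definition form_coef {K : fieldType} (d : nat) (f : {mpoly K[2]}) (k : nat) : K :=
  if (k <= d)%N then f@_(bimon d k) else 0.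

Lemma mcoeff_form_mulX (K : fieldType) (d0 e d i j : nat) (f : {mpoly K[2]}) :
  (d0 + e)%N = d -> (i <= e)%N -> (j <= d)%N ->
  (f * 'X_[bimon e i])@_(bimon d j) =
  if (i <= j)%N then form_coef d0 f (j - i) else 0.
Proof.
move=> eq_d le_ie le_jd; rewrite mcoeffMX_if /form_coef.
have -> : (bimon e i <= bimon d j)%MM = (e - i <= d - j)%N && (i <= j)%N.
  apply/mnm_lepP/andP => [le_m|[le0 le1] k].
    by have := le_m ord0; have := le_m ord_max; rewrite !bimon0 !bimon1.
  by rewrite !mnmE; case: ifP.
have [le_ij|] := boolP (i <= j)%N; last by rewrite andbF.
rewrite andbT (_ : (e - i <= d - j)%N = (j - i <= d0)%N); last by lia.
case: ifP => // le_d0; congr (f@_ _); apply: mnm2P; rewrite mnmBE ?bimon0 ?bimon1 //.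
by lia.
Qed.

Lemma dhomog_form_mulX (K : fieldType) (d0 e d i : nat) (f : {mpoly K[2]}) :
  f \is d0.-homog -> (d0 + e)%N = d -> (i <= e)%N ->
  f * 'X_[bimon e i] \is d.-homog.
Proof.
move=> homog_f <- le_ie; apply: dhomogM => //.
by rewrite dhomogX; apply/eqP; exact: mdeg_bimon.
Qed.

(** The minor is the value at the coefficients of both forms of a polynomial [P] over [F]. By
    algebraic independence it vanishes only if [P] = 0, which one specialization excludes. *)
Lemma generic_minor_neq0 (F K : fieldType) (iota : {rmorphism F -> K})
    (d1 d2 : nat) (f1 f2 : {mpoly K[2]}) (n1 n2 : nat) :
  generic_pair iota d1 d2 f1 f2 -> (n1 <= d2)%N ->
  \det (shift_mx n1 n2 (n1 + n2) (form_coef d1 f1) (form_coef d2 f2)) != 0.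
Proof.
case=> -[_ inj1 _] [_ inj2 _] neq12 indep le_n1.
pose t (i : 'I_(d1.+1 + d2.+1)) := match split i with
  | inl k => f1@_(bimon d1 k) | inr k => f2@_(bimon d2 k) end.
have coef1 (k : 'I_d1.+1) : form_coeff d1 f1 f1@_(bimon d1 k).
  by exists (bimon d1 k) => //; rewrite mdeg_bimon // -ltnS.
have coef2 (k : 'I_d2.+1) : form_coeff d2 f2 f2@_(bimon d2 k).
  by exists (bimon d2 k) => //; rewrite mdeg_bimon // -ltnS.
have tl (k : 'I_d1.+1) : t (lshift _ k) = f1@_(bimon d1 k).
  by rewrite /t (unsplitK (inl k)).
have tr (k : 'I_d2.+1) : t (rshift _ k) = f2@_(bimon d2 k).
  by rewrite /t (unsplitK (inr k)).
have bimon_inj d (k l : 'I_d.+1) : bimon d k = bimon d l -> k = l.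
  move/(congr1 (fun m : 'X_{1..2} => m ord_max)); rewrite !bimon1.
  exact: val_inj.
have deg_bimon d (k : 'I_d.+1) : mdeg (bimon d k) = d.
  by apply: mdeg_bimon; rewrite -ltnS.
(* Independence is stated for injective families: coefficients of one form differ by genericity of
   that form, those of different forms by the disjointness clause. *)
have t_inj : injective t.
  move=> i j; rewrite -[i]splitK -[j]splitK.
  case: (split i) => k; case: (split j) => l; rewrite ?tl ?tr => eq_t.
  - by rewrite (bimon_inj _ _ _ (inj1 _ _ (deg_bimon _ k) (deg_bimon _ l) eq_t)).
  - by case: (neq12 _ _ (coef1 k) (coef2 l)).
  - by case: (neq12 _ _ (coef1 l) (coef2 k)).
  - by rewrite (bimon_inj _ _ _ (inj2 _ _ (deg_bimon _ k) (deg_bimon _ l) eq_t)).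
(* Indeterminate versions of [form_coef], with the same guards, which also keep [inord] within
   range. *)
pose a k : {mpoly F[d1.+1 + d2.+1]} :=
  if (k <= d1)%N then 'X_(lshift _ (inord k)) else 0.
pose b k : {mpoly F[d1.+1 + d2.+1]} :=
  if (k <= d2)%N then 'X_(rshift _ (inord k)) else 0.
pose P := \det (shift_mx n1 n2 (n1 + n2) a b).
have PK : mmap iota t P =
    \det (shift_mx n1 n2 (n1 + n2) (form_coef d1 f1) (form_coef d2 f2)).
  rewrite /P -det_map_mx map_shift_mx; congr (\det _); apply: eq_shift_mx => k /=.
    rewrite /a /form_coef; case: ifP => [le_k|_]; last exact: mmap0.
    by rewrite mmapX mmap1U tl inordK.
  rewrite /b /form_coef; case: ifP => [le_k|_]; last exact: mmap0.
  by rewrite mmapX mmap1U tr inordK.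
(* The specialization f1 = x^d1, f2 = x^(d2 - n1) y^n1 gives the identity. *)
pose v (i : 'I_(d1.+1 + d2.+1)) : F := match split i with
  | inl k => (k == 0 :> nat)%:R | inr k => (k == n1 :> nat)%:R end.
have P1 : P.@[v] = 1.
  rewrite -[RHS](det1 F (n1 + n2)) -shift_mx1 /P -det_map_mx map_shift_mx.
  congr (\det _); apply: eq_shift_mx => k /=.
    rewrite /a; case: ifP => [le_k|gt_k].
      by rewrite mevalXU /v (unsplitK (inl _)) inordK.
    by rewrite meval0; case: eqP gt_k => // ->.
  rewrite /b; case: ifP => [le_k|gt_k].
    by rewrite mevalXU /v (unsplitK (inr _)) inordK.
  (* Beyond d2 the entry is 0, which agrees with the indicator of [n1] because [n1] is at most
     d2. *)
  by rewrite meval0; case: eqP gt_k => // ->; rewrite le_n1.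
have t_coef i : form_coeff d1 f1 (t i) \/ form_coeff d2 f2 (t i).
  by rewrite /t; case: split => k; [left|right].
apply/eqP; rewrite -PK => /(indep _ t t_inj t_coef) P0.
by move/eqP: P1; rewrite P0 meval0 eq_sym oner_eq0.
Qed.

(** * Leading monomials of the generic ideal in each degree *)

Section LeadingMonomials.

Context {F K : fieldType} {iota : {rmorphism F -> K}} {d1 d2 : nat}.
Context {f1 f2 : {mpoly K[2]}}.
Hypothesis f12_generic : generic_pair iota d1 d2 f1 f2.

Let I := ideal_gen (fun p => p = f1 \/ p = f2).

Let homog1 : f1 \is d1.-homog. Proof. by case: f12_generic => -[]. Qed.
Let homog2 : f2 \is d2.-homog. Proof. by case: f12_generic => _ []. Qed.

(* The dimension of I in degree d; the truncated subtractions make it valid in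
   every degree. *)
Definition hilbert_pair (d : nat) : nat := (minn d2 (d.+1 - d1) + (d.+1 - d2))%N.

Let N d : 'M[K]_(hilbert_pair d) :=
  shift_mx (minn d2 (d.+1 - d1)) (d.+1 - d2) (hilbert_pair d)
    (form_coef d1 f1) (form_coef d2 f2).

Let unitN d : N d \in unitmx.
Proof.
rewrite unitmxE unitfE.
exact: (generic_minor_neq0 (d.+1 - d2) f12_generic (geq_minl d2 (d.+1 - d1))).
Qed.

Lemma hilbert_pair_le d : (hilbert_pair d <= d.+1)%N.
Proof. by rewrite /hilbert_pair; lia. Qed.

(** Row j of the inverse of [N d] combines the chosen multiples into a form with coefficient 1 at
    [bimon d j] and 0 at the other first [hilbert_pair d] monomials. *)
Lemma LM_of_lt_hilbert_pair d j : (j < hilbert_pair d)%N ->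
  exists f, [/\ I f, f <> 0 & is_LM f (bimon d j)].
Proof.
move=> lt_j.
pose c := row (Ordinal lt_j) (invmx (N d)).
pose g (i : 'I_(hilbert_pair d)) : {mpoly K[2]} := match split i with
  | inl k => f1 * 'X_[bimon (d - d1) k] | inr k => f2 * 'X_[bimon (d - d2) k] end.
pose f := \sum_i c 0 i *: g i.
have cN : c *m N d = delta_mx 0 (Ordinal lt_j).
  by rewrite /c -row_mul mulVmx // row1.
have homog_g i : g i \is d.-homog.
  rewrite /g; case: split => k; have := ltn_ord k.
    by rewrite leq_min => /andP[_ lt_k]; apply: (dhomog_form_mulX homog1); lia.
  by move=> lt_k; apply: (dhomog_form_mulX homog2); lia.
have homog_f : f \is d.-homog by apply: rpred_sum => i _; exact: rpredZ.
have coef_f l (lt_l : (l < hilbert_pair d)%N) : f@_(bimon d l) = (l == j)%:R.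
  have le_ld : (l <= d)%N by have := hilbert_pair_le d; lia.
  transitivity ((c *m N d) 0 (Ordinal lt_l)); last by rewrite cN mxE.
  rewrite mxE raddf_sum; apply: eq_bigr => i _ /=; rewrite mcoeffZ; congr (_ * _).
  rewrite /N !mxE /g; case: split => k; have := ltn_ord k.
    by rewrite leq_min => /andP[_ lt_k]; apply: mcoeff_form_mulX; lia.
  by move=> lt_k; apply: mcoeff_form_mulX; lia.
have f_j : f@_(bimon d j) = 1 by rewrite coef_f ?eqxx.
exists f; split.
- apply: ideal_gen_sum => i; rewrite -mul_mpolyC /g; apply: ideal_genM.
  by case: split => k; rewrite mulrC; apply: ideal_genM; apply: ideal_gen_mem;
    [left|right].
- by move=> f0; move/eqP: f_j; rewrite f0 mcoeff0 eq_sym oner_eq0.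
split=> [|m m_f neq_m]; first by rewrite mcoeff_msupp f_j oner_eq0.
have deg_m : mdeg m = d := dhomog_mf homog_f m_f.
have le_jd : (j <= d)%N by have := hilbert_pair_le d; lia.
apply/grevlex_gt2; first by rewrite mdeg_bimon.
rewrite bimon1 ltnNge; apply/negP => le_mj.
move: m_f; rewrite mcoeff_msupp [m]bimonE deg_m coef_f; last by lia.
case: (eqVneq (m ord_max) j) => [eq_mj _|_]; last by rewrite eqxx.
by case: neq_m; rewrite (bimonE m) deg_m eq_mj.
Qed.

(** Only the component of [f] in the degree of [u] matters. It is a combination of the rows of [S];
    if it avoided the first [hilbert_pair d] monomials, invertibility of [N d] would make it 0. *)
Lemma LM_lt_hilbert_pair f u : I f -> is_LM f u ->
  (u ord_max < hilbert_pair (mdeg u))%N.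
Proof.
move=> If [u_f u_max]; set d := mdeg u.
(* From degree d1 + d2 on, [hilbert_pair d] is d + 1, so the bound is automatic. *)
have [le_d|lt_d] := leqP (d1 + d2) d.
  by have := le_mdeg2 u; rewrite -/d /hilbert_pair; lia.
pose S := shift_mx (minn d2 (d.+1 - d1)) (d.+1 - d2) d.+1
  (form_coef d1 f1) (form_coef d2 f2).
pose vec (p : {mpoly K[2]}) : 'rV_(d.+1) := \row_(j < d.+1) p@_(bimon d j).
have vec_lin (g p : {mpoly K[2]}) :
    (forall m, (vec (g * 'X_[m])%R <= S)%MS) -> (vec (p * g)%R <= S)%MS.
  move=> gS; have -> : vec (p * g) = \sum_(m <- msupp p) p@_m *: vec (g * 'X_[m]).
    apply/rowP=> j; rewrite summxE !mxE {1}[p]mpolyE mulr_suml raddf_sum.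
    by apply: eq_bigr => m _; rewrite !mxE -scalerAl /= mcoeffZ [g * _]mulrC.
  by apply: summx_sub => m _; apply: scalemx_sub.
have vec_mulX (d0 : nat) (g : {mpoly K[2]}) m : g \is d0.-homog ->
    vec (g * 'X_[m]) = if (d0 + mdeg m == d)%N
      then \row_j (if (m ord_max <= j)%N then form_coef d0 g (j - m ord_max) else 0)
      else 0.
  move=> homog_g; apply/rowP=> j; rewrite mxE.
  have le_jd : (j <= d)%N by rewrite -ltnS.
  have [eq_d|neq_d] := eqVneq (d0 + mdeg m)%N d; rewrite mxE.
    by rewrite {1}[m]bimonE; apply: mcoeff_form_mulX => //; exact: le_mdeg2.
  have homog_gm : g * 'X_[m] \is (d0 + mdeg m).-homog.
    by apply: dhomogM => //; rewrite dhomogX.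
  by apply: (dhomog_nemf_coeff homog_gm); rewrite /= mdeg_bimon // eq_sym.
have vec_S p : ideal_gen (fun p => p = f1 \/ p = f2) p -> (vec p <= S)%MS.
  move=> [s [Ss ->]].
  have -> : vec (\sum_(c <- s) c.1 * c.2) = \sum_(c <- s) vec (c.1 * c.2).
    apply/rowP=> j; rewrite summxE mxE raddf_sum.
    by apply: eq_bigr => c _; rewrite mxE.
  rewrite big_seq; apply: summx_sub => c /Ss[]->; apply: vec_lin => m.
    rewrite (vec_mulX _ _ _ homog1); case: eqP => [eq_d|_]; last exact: sub0mx.
    (* Here d < d1 + d2 enters: the multiplier has degree d - d1 < d2, so every multiple of [f1] in
       degree d is a row of [S]. *)
    have lt_m : (m ord_max < minn d2 (d.+1 - d1))%N by have := le_mdeg2 m; lia.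
    rewrite (_ : \row_j _ = row (lshift _ (Ordinal lt_m)) S); first exact: row_sub.
    by apply/rowP=> j; rewrite !mxE (unsplitK (inl _)).
  rewrite (vec_mulX _ _ _ homog2); case: eqP => [eq_d|_]; last exact: sub0mx.
  have lt_m : (m ord_max < d.+1 - d2)%N by have := le_mdeg2 m; lia.
  rewrite (_ : \row_j _ = row (rshift _ (Ordinal lt_m)) S); first exact: row_sub.
  by apply/rowP=> j; rewrite !mxE (unsplitK (inr _)).
have /submxP[c vec_f] := vec_S f If.
have coef_f (j : 'I_d.+1) : f@_(bimon d j) = (c *m S) 0 j.
  by rewrite -vec_f mxE.
rewrite ltnNge; apply/negP => le_u.
(* [N d] consists of the first columns of [S]; their monomials exceed [u], hence do not occur in
   [f]. *)
have cN0 : c *m N d = 0.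
  apply/rowP=> j; rewrite [RHS]mxE.
  have lt_jd : (j < d.+1)%N := leq_trans (ltn_ord j) (hilbert_pair_le d).
  transitivity ((c *m S) 0 (Ordinal lt_jd)).
    by rewrite !mxE; apply: eq_bigr => i _; rewrite !mxE.
  rewrite -coef_f /=; apply: memN_msupp_eq0; apply/negP => j_f.
  have lt_ju : (j < u ord_max)%N := leq_trans (ltn_ord j) le_u.
  have neq_ju : bimon d j <> u.
    by move=> eq_ju; move: lt_ju; rewrite -eq_ju bimon1 ltnn.
  have eq_d : mdeg u = mdeg (bimon d j) by rewrite mdeg_bimon // -ltnS.
  have /(grevlex_gt2 eq_d) := u_max _ j_f neq_ju.
  by rewrite bimon1 ltnNge (ltnW lt_ju).
have c0 : c = 0 by rewrite -(mulmxK (unitN d) c) cN0 mul0mx.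
have lt_ud : (u ord_max < d.+1)%N by rewrite ltnS le_mdeg2.
move: u_f; rewrite mcoeff_msupp [u]bimonE -/d (coef_f (Ordinal lt_ud)) c0 mul0mx.
by rewrite mxE eqxx.
Qed.

End LeadingMonomials.

Theorem theorem2p4 (F K : fieldType) (iota : {rmorphism F -> K})
    (K_infinite : infinite_type K) (d1 d2 : nat) (f1 f2 : {mpoly K[2]})
    (f12_generic : generic_pair iota d1 d2 f1 f2) :
  weakly_revlex (initial_ideal (ideal_gen (fun p => p = f1 \/ p = f2))).
Proof.
split=> [|u v [G [genG _] Gu] eq_d]; first by eexists => p; exact: iff_refl.
move/(grevlex_gt2 eq_d) => lt_vu.
have /genG/initial_idealX[f [If _ fu]] : monomial_span G ('X_[u] : {mpoly K[2]}).
  by apply: ideal_gen_mem; exists u.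
(* The y exponent of [u] is below the bound for its degree, and that of [v] is smaller still. *)
have lt_u := LM_lt_hilbert_pair f12_generic If fu.
apply/initial_idealX; rewrite [v]bimonE eq_d.
exact: (LM_of_lt_hilbert_pair f12_generic) (ltn_trans lt_vu lt_u).
Qed.
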